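(* Let $X$ be a Banach space and let $C$ be a norm bounded subset of the dual $X^*$. Suppose that $(C,\gamma)$ is a complete pseudometric space having the weak$^*$-uniform separation property in $X^*$, with modulus of uniform separation $\varpi_C$. Let $f: C \to \mathbb{R}\cup\{+\infty\}$ be any proper bounded from below function. Then there exists $a>0$ such that for every $\varepsilon\in\,]0,a]$ and every $p^*\in C$ such that $f(p^* )<\inf_C f+\varepsilon\,\varpi_C(\varepsilon)$, there exist $x\in X$ and $u\in C$ such that (i) $\gamma(p^*,u)\le\varepsilon$; (ii) $\|x\|<2\varepsilon$; (iii) $f+\hat{x}$ attains $\gamma$-strongly-directionally its infimum over $C$ at the direction $u$.
   Context: Banach spaces are real. $B_X$ is the closed unit ball of $X$. For $x\in X$, $\hat{x}$ denotes the evaluation map $x^*\mapsto \langle x^*,x\rangle$ on $X^*$. A function is proper if it is not identically $+\infty$. Pseudometric: for a nonempty set $C$, a map $\gamma:C\times C\to\mathbb{R}^+=[0,\infty)$ with $\gamma(x,x)=0$, $\gamma(x,y)=\gamma(y,x)$ and $\gamma(x,y)\le\gamma(x,z)+\gamma(z,y)$ for all $x,y,z\in C$ (distinct points may be at distance $0$). Put $x\sim y$ iff $\gamma(x,y)=0$; $(C,\gamma)$ is complete if the quotient $C/\!\sim$ with the induced metric is a complete metric space. No relation between $\gamma$ and the norm of $X^*$ is assumed. Weak$^*$-uniform separation property ($w^*\mathcal{USP}$): for $C\subset X^*$ and a pseudometric space $(C,\gamma)$, we say $(C,\gamma)$ has the $w^*\mathcal{USP}$ in $X^*$ if there exists $a>0$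 such that for every $\varepsilon\in\,]0,a]$ there exists $\varpi_C(\varepsilon)>0$ such that for every $p\in C$ there exists $x_{p,\varepsilon}\in B_X$ with $$\langle p,x_{p,\varepsilon}\rangle-\varpi_C(\varepsilon)\ge\langle q,x_{p,\varepsilon}\rangle\quad\text{for all } q\in C \text{ with } \gamma(q,p)\ge\varepsilon.$$ A function $\varpi_C$ as in this definition (defined on the interval $]0,a]$ of the definition) is called the modulus of uniform separation of $(C,\gamma)$. In the claim, $\varpi_C$ is fixed, and the constant $a$ of the claim is such that $\varpi_C$ is defined on $]0,a]$. Strongly directional infimum: a proper bounded from below function $g:C\to\mathbb{R}\cup\{+\infty\}$ attains $\gamma$-strongly-directionally its infimum over $C$ at a direction $u\in C$ if for every sequence $(q_n)\subset C$, $\lim_n g(q_n)=\inf_C g$ implies $\lim_n\gamma(q_n,u)=0$. (It is not required that $g(u)=\inf_C g$.) *)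

(* Defs.v *)
From HB Require Import structures.
From mathcomp Require Import all_boot all_order all_algebra generic_quotient.
From mathcomp Require Import all_classical all_reals all_analysis.

Set Implicit Arguments.
Unset Strict Implicit.
Unset Printing Implicit Defensive.

Import Order.TTheory GRing.Theory Num.Theory.
Import numFieldNormedType.Exports.
Local Open Scope classical_set_scope.
Local Open Scope ring_scope.
Local Open Scope quotient_scope.

Record dual (R : realType) (X : normedModType R) := Dual {
  dual_fun :> {linear X -> R^o};
  dual_continuous : continuous dual_fun }.

HB.instance Definition _ (R : realType) (X : normedModType R) :=
  gen_eqMixin (dual X).
HB.instance Definition _ (R : realType) (X : normedModType R) :=
  gen_choiceMixin (dual X).

Definition dual_norm (R : realType) (X : normedModType R) (p : dual X) : R :=
  sup [set `|p x| | x in [set x : X | `|x| <= 1]].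

(* [sup] is total: this checks that it is a genuine supremum here. *)
Lemma dual_norm_has_sup (R : realType) (X : normedModType R) (p : dual X) :
  has_sup [set `|p x| | x in [set x : X | `|x| <= 1]].
Proof.
split; first by exists `|p 0|, 0 => //=; rewrite normr0 ler01.
have /bounded_funP/(_ 1)[M pM] : bounded_near (dual_fun p) (nbhs (0 : X)).
  exact/continuous_linear_bounded/(@dual_continuous _ _ p).
by exists M => _ [x /= x1 <-]; exact: pM.
Qed.

Definition norm_bounded (R : realType) (X : normedModType R)
  (C : set (dual X)) := exists M : R, forall p, C p -> dual_norm p <= M.

Record pseudometric (R : realType) (T : Type) := Pseudometric {
  pdist :> T -> T -> R;
  pdist_ge0 : forall x y, 0 <= pdist x y;
  pdistxx : forall x, pdist x x = 0;
  pdistC : forall x y, pdist x y = pdist y x;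
  pdist_triangle : forall x y z, pdist x y <= pdist x z + pdist z y }.

Section metric_quotient.
Context {R : realType} {T : choiceType} (d : pseudometric R T).

Definition pdist_eq0 : rel T := fun x y => d x y == 0.

Lemma pdist_eq0_refl : reflexive pdist_eq0.
Proof. by move=> x; rewrite /pdist_eq0 pdistxx. Qed.

Lemma pdist_eq0_sym : symmetric pdist_eq0.
Proof. by move=> x y; rewrite /pdist_eq0 pdistC. Qed.

Lemma pdist_eq0_trans : transitive pdist_eq0.
Proof.
move=> y x z /eqP xy /eqP yz; rewrite /pdist_eq0 eq_le pdist_ge0 andbT.
by rewrite (le_trans (pdist_triangle d x z y))// xy yz addr0.
Qed.

Canonical pdist_eq0_equiv :=
  EquivRel pdist_eq0 pdist_eq0_refl pdist_eq0_sym pdist_eq0_trans.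

Definition metric_quotient := {eq_quot pdist_eq0}.
HB.instance Definition _ := Choice.on metric_quotient.
HB.instance Definition _ := EqQuotient.on metric_quotient.

Definition quotient_dist (A B : metric_quotient) : R := d (repr A) (repr B).

Lemma quotient_distE x y :
  quotient_dist (\pi_metric_quotient x) (\pi_metric_quotient y) = d x y.
Proof.
have reprK z : d z (repr (\pi_metric_quotient z)) = 0.
  by apply/eqP; apply/(@eqquotP _ _ (metric_quotient)); rewrite reprK.
apply/eqP; rewrite /quotient_dist eq_le; apply/andP; split.
- apply: le_trans (pdist_triangle _ _ _ x) _.
  rewrite pdistC reprK add0r; apply: le_trans (pdist_triangle _ _ _ y) _.
  by rewrite reprK addr0.
- apply: le_trans (pdist_triangle _ _ _ (repr (\pi_metric_quotient x))) _.
  rewrite reprK add0r.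
  apply: le_trans (pdist_triangle _ _ _ (repr (\pi_metric_quotient y))) _.
  by rewrite [X in _ + X]pdistC reprK addr0.
Qed.

Let quotient_distxx A : quotient_dist A A = 0. Proof. exact: pdistxx. Qed.

Let quotient_dist_positivity A B : quotient_dist A B = 0 -> A = B.
Proof.
by move=> AB0; rewrite -[A]reprK -[B]reprK; apply/(@eqquotP _ _ metric_quotient)/eqP.
Qed.

Let quotient_distC A B : quotient_dist A B = quotient_dist B A.
Proof. exact: pdistC. Qed.

Let quotient_dist_triangle B A D :
  quotient_dist A D <= quotient_dist A B + quotient_dist B D.
Proof. exact: pdist_triangle. Qed.

HB.instance Definition _ := @isMetric.Build R metric_quotient quotient_dist
  quotient_distxx quotient_dist_positivity quotient_distC
  quotient_dist_triangle.

End metric_quotient.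

Definition complete_metric (R : realType) (M : metricType R) :=
  forall s : nat -> M, cauchy (s @ \oo) -> exists l : M, s @ \oo --> l.

Definition complete_pseudometric (R : realType) (T : choiceType)
  (d : pseudometric R T) := complete_metric (metric_quotient d : metricType R).

Section uniform_separation.
Context {R : realType} {X : normedModType R} {C : set (dual X)}.
Variable gamma : pseudometric R C.

Definition separates (eps w : R) :=
  forall p : C, exists2 x : X, `|x| <= 1 &
    forall q : C, eps <= gamma q p -> val q x <= val p x - w.

Definition wUSP := exists2 a : R, 0 < a &
  forall eps, 0 < eps <= a -> exists2 w : R, 0 < w & separates eps w.

(* [varpi] is only meaningful on ]0, a]. *)
Definition wUSP_modulus (a : R) (varpi : R -> R) := 0 < a /\
  forall eps, 0 < eps <= a -> 0 < varpi eps /\ separates eps (varpi eps).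

Lemma wUSPP : wUSP <-> exists a varpi, wUSP_modulus a varpi.
Proof.
split=> [[a a0 sep]|[a [varpi [a0 sep]]]]; last first.
  by exists a => // eps /sep[]; exists (varpi eps).
have /choice[varpi varpiP] : forall eps, exists w, 0 < eps <= a ->
    0 < w /\ separates eps w.
  move=> eps; have [/sep[w w0 wP]|_] := boolP (0 < eps <= a); first by exists w.
  by exists 0.
by exists a, varpi.
Qed.

End uniform_separation.

Section extended_real_functions.
Context {R : realType} {T : Type}.
Implicit Type g : T -> \bar R.

Definition proper_fun g := exists p, g p <> +oo%E.

(* This also rules out the value -oo. *)
Definition bounded_below g := exists m : R, forall p, (m%:E <= g p)%E.

Definition attains_strongly_directionally (gamma : pseudometric R T) g (u : T) :=
  [/\ proper_fun g, bounded_below g &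
    forall q : nat -> T, g (q n) @[n --> \oo] --> ereal_inf (range g) ->
      gamma (q n) u @[n --> \oo] --> (0 : R)].

End extended_real_functions.

(* Main.v *)
Require Import Defs.
From HB Require Import structures.
From mathcomp Require Import all_boot all_order all_algebra.
From mathcomp Require Import all_classical all_reals all_analysis.
From mathcomp Require Import lra.
Set Implicit Arguments.
Unset Strict Implicit.
Unset Printing Implicit Defensive.
Import Order.TTheory GRing.Theory Num.Theory.
Import numFieldNormedType.Exports.
Local Open Scope classical_set_scope.
Local Open Scope ring_scope.

(** Adding a continuous linear functional to [f] tilts it.  If [p] nearly
    minimizes [f], then tilting by [- eps *: x], where [x] separates [p] from
    the points at distance at least [eps], raises every such point above the
    value at [p]: some nonempty strict sublevel set of the tilted function, a
    slice, lies in the [gamma]-ball of radius [eps] about [p]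
    ([separates_has_slice]).  The modulus enters only through the product
    [t * w], the height gained by a tilt of size [t].

    A slice lying in a ball persists under uniformly small perturbations
    ([has_slice_perturb]), and, [C] being bounded, small tilts are such
    ([has_slice_tilt_near]).  Hence the tilts [x] for which [f + x] has a slice
    in some ball of radius [r] form an open set; it is dense because any
    tilted function has near-minimizers as good as one wishes, around which the
    separation property produces a slice of radius [r] at the cost of an
    arbitrarily small further tilt.  By Baire's theorem, arbitrarily close to
    the first tilt there is an [x] for which [f + x] has slices at all scales.
    As slices of one function are nested, their centres form a Cauchy sequence,
    and its limit [u] attracts every minimizing sequence
    ([slices_strong_minimum]).  Being close to the first tilt, [x] keeps the
    slice about [p], which yields [gamma p u <= eps], and has norm below
    [2 * eps]. *)

(** * Slices *)

Section slices.
Context {R : realType} {T : Type} (gamma : pseudometric R T).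
Implicit Types (g : T -> \bar R) (p u : T) (r : R).

(** The level [c] is a real number lying above some value of [g] rather than
    [ereal_inf (range g) + eta], so that no finiteness of the infimum has to be
    carried along. *)
Definition has_slice g p r := exists2 c : R,
  exists z, (g z < c%:E)%E & forall q, (g q < c%:E)%E -> gamma q p < r.

Lemma has_slice_le g p r r' : r <= r' -> has_slice g p r -> has_slice g p r'.
Proof.
by move=> rr' [c z gc]; exists c => // q /gc /lt_le_trans; exact.
Qed.

(** If [g z < b < c], a perturbation of size at most [(c - b) / 2] leaves [z]
    below the midpoint of [b] and [c], and a point where the perturbed function
    is below that midpoint was below [c] before. *)
Lemma has_slice_perturb g p r : has_slice g p r ->
  exists2 s : R, 0 < s & forall h : T -> R, (forall q, `|h q| <= s) ->
    has_slice (fun q => g q + (h q)%:E)%E p r.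
Proof.
move=> [c [z gzc] gc].
have [b bc gzb] : exists2 b, b < c & (g z < b%:E)%E.
  case: (g z) gzc => [v| |]// vc; last by exists (c - 1); [lra|rewrite ltNyr].
  by rewrite lte_fin in vc; exists ((v + c) / 2); rewrite ?lte_fin; lra.
exists ((c - b) / 2); first lra.
move=> h hs; exists (c - (c - b) / 2).
  exists z; move: (hs z); rewrite ler_norml => /andP[_ hz].
  case: (g z) gzb => [v| |]//; last by move=> _; rewrite addNye ltNyr.
  by rewrite -EFinD !lte_fin; lra.
move=> q; move: (hs q); rewrite ler_norml => /andP[hq _].
move=> gq; apply: gc.
case: (g q) gq => [v| |]//; last by move=> _; rewrite ltNyr.
by rewrite -EFinD !lte_fin; lra.
Qed.

(** Sublevel sets of one function are nested, so the lower of the two slices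
    contains a point common to both. *)
Lemma slice_centers_close g p p' r r' :
  has_slice g p r -> has_slice g p' r' -> gamma p p' < r + r'.
Proof.
move=> [c [z gzc] gc] [c' [z' gz'c'] gc'].
have [q gqc gqc'] : exists2 q, (g q < c%:E)%E & (g q < c'%:E)%E.
  have [cc'|/ltW c'c] := leP c c'.
    by exists z => //; rewrite (lt_le_trans gzc)// lee_fin.
  by exists z' => //; rewrite (lt_le_trans gz'c')// lee_fin.
rewrite (le_lt_trans (pdist_triangle _ _ _ q))// pdistC ltrD//.
  exact: gc.
exact: gc'.
Qed.

Lemma minimizing_in_slice g p r (q : nat -> T) : has_slice g p r ->
  g (q n) @[n --> \oo] --> ereal_inf (range g) ->
  \forall n \near \oo, gamma (q n) p < r.
Proof.
move=> [c [z gzc] gc] qinf.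
have infc : (ereal_inf (range g) < c%:E)%E.
  by rewrite (le_lt_trans _ gzc)//; apply: ereal_inf_lbound; exists z.
have /qinf qc : nbhs (ereal_inf (range g)) [set y | (y < c%:E)%E].
  by apply: open_nbhs_nbhs; split; [exact: open_ereal_lt_ereal|].
by near=> n; apply: gc; near: n.
Unshelve. all: by end_near. Qed.

End slices.

(** * Completeness *)

(** Completeness is given on the quotient; here it is pulled back to the points
    themselves, a representative of the limit class serving as the limit. *)
Lemma complete_pseudometric_cvg (R : realType) (T : choiceType)
    (gamma : pseudometric R T) (s : nat -> T) :
  complete_pseudometric gamma ->
  (forall e, 0 < e -> exists N, forall n, (N <= n)%N -> gamma (s N) (s n) < e) ->
  exists u, forall e, 0 < e -> \forall n \near \oo, gamma (s n) u < e.
Proof.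
move=> comp sc.
pose pi x : metric_quotient gamma := (\pi_(metric_quotient gamma) x)%qT.
have ballE A B e :
    ball (A : metric_quotient gamma) e B = (quotient_dist A B < e) by [].
have [|l sl] := comp (pi \o s).
  apply: cauchy_exP => e e0; have [N sN] := sc e e0.
  exists (pi (s N)), N => // n /= Nn; rewrite ballE quotient_distE; exact: sN.
exists (repr l) => e e0.
have /sl se : nbhs l (ball l e) by apply: nbhsx_ballx.
near=> n; have : ball l e (pi (s n)) by near: n.
by rewrite ballE -[l in quotient_dist l]reprK quotient_distE pdistC.
Unshelve. all: by end_near. Qed.

Section well_posedness.
Context {R : realType} {T : choiceType} (gamma : pseudometric R T).

(** The limit of the centres is within [r] of the centre of any slice of radius
    [r]: a large index makes both the slice about [s n] and the distance from
    [s n] to the limit negligible. *)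
Lemma slices_strong_minimum (g : T -> \bar R) :
  complete_pseudometric gamma -> proper_fun g -> bounded_below g ->
  (forall r, 0 < r -> exists p, has_slice gamma g p r) ->
  exists2 u, attains_strongly_directionally gamma g u &
    forall p r, has_slice gamma g p r -> gamma p u <= r.
Proof.
move=> comp gp gb gs.
have /choice[s sP] n : exists p, has_slice gamma g p n.+1%:R^-1 by exact: gs.
have small (e : R) : 0 < e -> \forall n \near \oo, n.+1%:R^-1 < e.
  by move=> e0; exact: near_infty_natSinv_lt (PosNum e0).
have [e e0|u su] := complete_pseudometric_cvg (s := s) comp.
  have [N _ NP] := small (e / 2) ltac:(lra).
  exists N => n Nn; apply: lt_trans (slice_centers_close (sP N) (sP n)) _.
  by rewrite [ltRHS]splitr ltrD//; apply: NP => /=.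
exists u.
  split=> // q qinf; apply/cvgrPdist_lt => e e0.
  have [n [ne nu]] : exists n, n.+1%:R^-1 < e / 2 /\ gamma (s n) u < e / 2.
    near \oo => n; exists n; split; near: n; [apply: small|apply: su]; lra.
  have := minimizing_in_slice (sP n) qinf; apply: filterS => k qs.
  rewrite sub0r normrN ger0_norm ?pdist_ge0//.
  rewrite (le_lt_trans (pdist_triangle _ _ _ (s n)))//.
  by rewrite [ltRHS]splitr ltrD// (lt_trans qs).
move=> p r pr; apply/ler_addgt0Pr => e e0.
have [n [ne nu]] : exists n, n.+1%:R^-1 < e / 2 /\ gamma (s n) u < e / 2.
  near \oo => n; exists n; split; near: n; [apply: small|apply: su]; lra.
apply: le_trans (pdist_triangle _ _ _ (s n)) _.
rewrite [in leRHS](splitr e) addrA lerD ?(ltW nu)//.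
by rewrite (le_trans (ltW (slice_centers_close pr (sP n))))// lerD2l ltW.
Unshelve. all: by end_near. Qed.

End well_posedness.

(** * Tilts by continuous linear functionals *)

Section dual_perturbation.
Context {R : realType} {X : normedModType R} {C : set (dual X)}.
Implicit Types (f g : C -> \bar R) (x y : X).

Definition tilt f x : C -> \bar R := fun q => (f q + (val q x)%:E)%E.

Lemma tiltD f x y : tilt f (x + y) = tilt (tilt f x) y.
Proof. by apply/funext => q; rewrite /tilt linearD EFinD addeA. Qed.

Lemma proper_tilt f x : proper_fun f -> proper_fun (tilt f x).
Proof. by move=> [p fp]; exists p; rewrite /tilt; case: (f p) fp. Qed.

Lemma norm_bounded_pairing : norm_bounded C ->
  exists2 M : R, 0 < M & forall (q : C) x, `|val q x| <= M * `|x|.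
Proof.
move=> [M0 CM0]; exists (Num.max M0 1); first by rewrite lt_max ltr01 orbT.
move=> q x; have [->|x0] := eqVneq x 0; first by rewrite linear0 !normr0 mulr0.
have nx0 : 0 < `|x| by rewrite normr_gt0.
have q1 : `|val q (`|x|^-1 *: x)| <= M0.
  apply: le_trans (CM0 _ (set_valP q)).
  apply: ub_le_sup; first by have [] := dual_norm_has_sup (val q).
  exists (`|x|^-1 *: x) => //=.
  by rewrite normrZ normfV normr_id mulVf// gt_eqF.
rewrite -ler_pdivrMr// mulrC le_max; apply/orP; left.
by move: q1; rewrite linearZ/= normrM normfV normr_id.
Qed.

Lemma bounded_below_tilt f x :
  norm_bounded C -> bounded_below f -> bounded_below (tilt f x).
Proof.
move=> /norm_bounded_pairing[M _ qM] [m fm]; exists (m - M * `|x|) => q.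
rewrite EFinD; apply: leeD => //; rewrite lee_fin.
by have := qM q x; rewrite ler_norml => /andP[].
Qed.

Variables (gamma : pseudometric R C).

(** With [m] the infimum of [g] and [x] the separating vector, the slice at
    level [m + t * w - t * val p x] of the tilt by [- t *: x] contains [p] since
    [g p < m + t * w]; at a point [q] with [gamma q p >= r] the tilted function
    is at least [m - t * val q x], which is at least that level. *)
Lemma separates_has_slice g (p : C) r t w :
  separates gamma r w -> 0 < t -> (g p < ereal_inf (range g) + (t * w)%:E)%E ->
  exists2 y, `|y| <= t & has_slice gamma (tilt g y) p r.
Proof.
move=> sep t0 gp; have [x x1 xsep] := sep p.
have gge q : (ereal_inf (range g) <= g q)%E by apply: ereal_inf_lbound; exists q.
case: (ereal_inf (range g)) gp gge => [m| |]//.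
  move=> gp gge; exists (- t *: x).
    by rewrite normrZ normrN gtr0_norm// ler_piMr// ltW.
  exists (m + t * w - t * val p x).
    exists p; rewrite /tilt linearZ/=.
    case: (g p) gp => [v| |]//; last by move=> _; rewrite addNye ltNyr.
    by rewrite -!EFinD !lte_fin /GRing.scale/=; lra.
  move=> q gq; rewrite ltNge; apply/negP => /xsep qp; move: gq.
  rewrite /tilt linearZ/=; have := gge q; case: (g q) => [v| |]//.
  rewrite -!EFinD !lte_fin !lee_fin /GRing.scale/= => mv.
  by move: qp; rewrite -(ler_pM2l t0); lra.
  by move=> gp /(_ p); rewrite leye_eq => /eqP gpy; move: gp; rewrite gpy.
by rewrite addNye ltNge leNye.
Qed.

Lemma has_slice_tilt_near g p r : norm_bounded C -> has_slice gamma g p r ->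
  exists2 d : R, 0 < d & forall y, `|y| < d -> has_slice gamma (tilt g y) p r.
Proof.
move=> /norm_bounded_pairing[M M0 qM] gp.
have [s s0 gs] := has_slice_perturb gp.
exists (s / M); first exact: divr_gt0.
move=> y yd; apply: gs => q; rewrite (le_trans (qM q y))//.
by rewrite mulrC -ler_pdivlMr// ltW.
Qed.

End dual_perturbation.

(** * Genericity *)

Section generic_slices.
Context {R : realType} {X : normedModType R} {C : set (dual X)}.
Variables (gamma : pseudometric R C) (f : C -> \bar R).

Definition sliced (r : R) : set X :=
  [set x | exists p, has_slice gamma (tilt f x) p r].

Lemma open_sliced r : norm_bounded C -> open (sliced r).
Proof.
move=> hC; rewrite openE => x [p fp].
have [d d0 dP] := has_slice_tilt_near hC fp.
apply/nbhs_ballP; exists d => // z; rewrite -ball_normE/= distrC => xz.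
by exists p; rewrite -(subrK x z) addrC tiltD; exact: dP.
Qed.

(** Given [x], separate a near-minimizer of [f + x] with a tilt of size [d / 2];
    the gap required of the near-minimizer is [d / 2 * w r'], positive. *)
Lemma dense_sliced r a w : norm_bounded C -> proper_fun f -> bounded_below f ->
  wUSP_modulus gamma a w -> 0 < r -> dense (sliced r).
Proof.
move=> hC fp fb [a0 aw] r0 O [x Ox] oO.
have [d /= d0 dO] : exists2 d : R, 0 < d & ball x d `<=` O.
  by apply/nbhs_ballP; exact: open_nbhs_nbhs.
(* The modulus is only available up to [a]. *)
set r' := Num.min r a.
have [|w0 sep] := aw r'; first by rewrite /r' lt_min r0 a0 ge_min lexx orbT.
set g := tilt f x.
have d20 : 0 < d / 2 by lra.
have [_ [p _ <-] gp] : exists2 v, range g v &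
    (v < ereal_inf (range g) + (d / 2 * w r')%:E)%E.
  apply: lb_ereal_inf_adherent; first exact: mulr_gt0.
  have [m gm] := bounded_below_tilt x hC fb.
  have [q gq] := proper_tilt x fp.
  rewrite fin_numE; apply/andP; split.
    rewrite gt_eqF// (lt_le_trans (ltNyr m))//.
    by apply/ereal_infP => _ [k _ <-].
  rewrite lt_eqF// (@le_lt_trans _ _ (g q))//.
    by apply: ereal_inf_lbound; exists q.
  by rewrite ltey; apply/eqP.
have [y yd ys] := separates_has_slice sep d20 gp.
exists (x + y); split.
  apply: dO; rewrite -ball_normE/= opprD addrA subrr sub0r normrN; lra.
exists p; rewrite tiltD; apply: has_slice_le ys.
by rewrite /r' ge_min lexx.
Qed.

End generic_slices.

Theorem theorem2 (R : realType) (X : completeNormedModType R)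
    (C : set (dual X)) (hC0 : C !=set0) (hC : norm_bounded C)
    (gamma : pseudometric R C) (hgamma : complete_pseudometric gamma)
    (a0 : R) (varpi : R -> R) (hvarpi : wUSP_modulus gamma a0 varpi)
    (f : C -> \bar R) (hf : proper_fun f) (hfb : bounded_below f) :
  exists2 a : R, 0 < a <= a0 &
    forall eps : R, 0 < eps <= a ->
    forall p : C, (f p < ereal_inf (range f) + (eps * varpi eps)%:E)%E ->
    exists (x : X) (u : C),
      [/\ gamma p u <= eps,
          `|x| < 2 * eps &
          attains_strongly_directionally gamma
            (fun q : C => (f q + (val q x)%:E)%E) u].
Proof.
have [a00 aP] := hvarpi.
exists a0; first by rewrite a00 lexx.
move=> eps epsa p fp; have [_ sep] := aP _ epsa.
have eps0 : 0 < eps by case/andP: epsa.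
have [y yeps ys] := separates_has_slice sep eps0 fp.
have [d d0 dP] := has_slice_tilt_near hC ys.
pose U n := sliced gamma f n.+1%:R^-1.
have Ude : dense (\bigcap_n U n).
  apply: Baire => n; split; first exact: open_sliced.
  by apply: (dense_sliced hC hf hfb hvarpi).
(* Radius [eps] keeps the norm below [2 * eps]; radius [d] keeps the slice. *)
pose e := Num.min eps d.
have e0 : 0 < e by rewrite lt_min eps0.
have [||x [yx Ux]] := Ude (ball y e).
- by exists y; exact: ballxx.
- exact: ball_open.
have xy : `|x - y| < e by move: yx; rewrite -ball_normE/= distrC.
have [||r r0|u ux uslice] := slices_strong_minimum (g := tilt f x) hgamma.
- exact: proper_tilt.
- exact: bounded_below_tilt.
- near \oo => n; have [v vn] := Ux n I; exists v.
  apply: has_slice_le vn; apply: ltW.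
  by near: n; exact: near_infty_natSinv_lt (PosNum r0).
exists x, u; split=> //.
  apply: uslice; rewrite -(subrK y x) addrC tiltD; apply: dP.
  by rewrite (lt_le_trans xy)// /e ge_min lexx orbT.
rewrite -(subrK y x) (le_lt_trans (ler_normD _ _))//.
by have : e <= eps; [rewrite /e ge_min lexx|lra].
Unshelve. all: by end_near. Qed.
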